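(* For every integer $h \ge 3$ there are constants $\varepsilon_0,\delta_0,C>0$ such that if $H$ is a graph on $h$ vertices and $0<\varepsilon \le \varepsilon_0$, then $$\mathrm{Rem}_H(\varepsilon) \le \big[S(\varepsilon^{C},\,\delta_0,\,\varepsilon)\big]^C .$$
   Context: All graphs are finite and simple. For vertex sets $A,B$ of a graph $G$, $e_G(A,B)$ is the number of ordered pairs $(u,v)\in A\times B$ with $uv\in E(G)$, and $d_G(A,B)=e_G(A,B)/(|A||B|)$. A pair $(A,B)$ is $\epsilon$-regular if $|d_G(A,B)-d_G(A',B')|\le \epsilon$ for all $A'\subseteq A$, $B'\subseteq B$ with $|A'|\ge\epsilon|A|$, $|B'|\ge\epsilon|B|$. An equipartition is a partition of $V(G)$ whose part sizes differ by at most $1$; its order is its number of parts. An equipartition $\{Z_1,\dots,Z_k\}$ is $\epsilon$-regular if all pairs $(Z_i,Z_j)$ but at most $\epsilon k^2$ are $\epsilon$-regular. The density of a graph $G=(V,E)$ is $d_G=2|E|/|V|^2$. For $\epsilon,\delta,p>0$, $S(\epsilon,\delta,p)$ denotes the smallest integer $S$ such that for every graph $G$ of density at least $p$ and every equipartition $\mathcal P_0$ of $V(G)$ of order at most $1/\epsilon$, one can add/remove at most $\delta|E(G)|$ edges so that the resulting graph has an $\epsilon$-regular equipartition that refines $\mathcal P_0$ and has order at most $S$. For a fixed graph $H$ on $h$ vertices, $\mathrm{Rem}_H(\varepsilon)$ denotes the smallest value $R$ such that every $n$-vertex graph $G$ from which one must remove at least $\varepsilon n^2$ edges in order to make it $H$-free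 contains at least $n^h/R$ copies of $H$. *)

(* Defs.v *)
From HB Require Import structures.
From mathcomp Require Import all_boot all_order all_algebra.
From mathcomp Require Import reals exp.
Set Implicit Arguments. Unset Strict Implicit. Unset Printing Implicit Defensive.
Import Order.TTheory GRing.Theory Num.Theory.
Local Open Scope ring_scope.

Section Defs.
Variable R : realType.

Definition graph_wf (n : nat) (E : {set {set 'I_n}}) : bool :=
  [forall e in E, #|e| == 2%N].

Definition adj (n : nat) (E : {set {set 'I_n}}) (u v : 'I_n) : bool :=
  [set u; v] \in E.

Definition gdensity (n : nat) (E : {set {set 'I_n}}) : R :=
  (2 * #|E|)%:R / (n ^ 2)%:R.

Definition eG (n : nat) (E : {set {set 'I_n}}) (A B : {set 'I_n}) : nat :=
  #|[set p in setX A B | adj E p.1 p.2]|.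

Definition dG (n : nat) (E : {set {set 'I_n}}) (A B : {set 'I_n}) : R :=
  (eG E A B)%:R / (#|A| * #|B|)%:R.

Definition regular_pair (n : nat) (E : {set {set 'I_n}}) (eps : R)
    (A B : {set 'I_n}) : bool :=
  [forall A' in powerset A, forall B' in powerset B,
     ((eps * #|A|%:R <= #|A'|%:R) && (eps * #|B|%:R <= #|B'|%:R)) ==>
     (`|dG E A B - dG E A' B'| <= eps)].

Definition equipartition (n : nat) (P : {set {set 'I_n}}) : bool :=
  partition P [set: 'I_n] &&
  [forall A in P, forall B in P, #|A| <= #|B| + 1]%N.

Definition irregular_pairs (n : nat) (E : {set {set 'I_n}}) (eps : R)
    (P : {set {set 'I_n}}) : {set {set {set 'I_n}}} :=
  [set AB in powerset P | (#|AB| == 2%N) &&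
     [exists A in AB, exists B in AB, (A != B) && ~~ regular_pair E eps A B]].

Definition regular_equipartition (n : nat) (E : {set {set 'I_n}}) (eps : R)
    (P : {set {set 'I_n}}) : bool :=
  equipartition P && ((#|irregular_pairs E eps P|)%:R <= eps * (#|P| ^ 2)%:R).

Definition refines (n : nat) (Q P : {set {set 'I_n}}) : bool :=
  [forall B in Q, exists A in P, B \subset A].

(* S satisfies the defining property of S(eps, delta, p); the quantity
   S(eps, delta, p) is the least natural number with this property. *)
Definition S_prop (eps delta p : R) (S : nat) : Prop :=
  forall (n : nat) (E : {set {set 'I_n}}), graph_wf E -> p <= gdensity E ->
  forall P0 : {set {set 'I_n}}, equipartition P0 -> #|P0|%:R <= eps^-1 ->
  exists E' : {set {set 'I_n}}, graph_wf E' /\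
    #|(E :\: E') :|: (E' :\: E)|%:R <= delta * #|E|%:R /\
    exists Q : {set {set 'I_n}}, regular_equipartition E' eps Q /\
      refines Q P0 /\ (#|Q| <= S)%N.

Definition embeddings (h n : nat) (EH : {set {set 'I_h}}) (E : {set {set 'I_n}})
  : {set {ffun 'I_h -> 'I_n}} :=
  [set f : {ffun 'I_h -> 'I_n} | injectiveb f && [forall e in EH, (f @: e) \in E]].

(* number of copies of H in G: distinct subgraphs (vertex set, edge set)
   of G that are images of H under an embedding *)
Definition copies (h n : nat) (EH : {set {set 'I_h}}) (E : {set {set 'I_n}}) : nat :=
  #|[set (f @: [set: 'I_h], [set f @: e | e : {set 'I_h} in EH]) | f : {ffun 'I_h -> 'I_n} in embeddings EH E]|.

Definition Hfree (h n : nat) (EH : {set {set 'I_h}}) (E : {set {set 'I_n}}) : bool :=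
  embeddings EH E == set0.

(* X satisfies the defining property of Rem_H(eps); Rem_H(eps) is the least
   such value, so (the property being upward closed and closed)
   Rem_H(eps) <= X iff Rem_prop EH eps X. *)
Definition Rem_prop (h : nat) (EH : {set {set 'I_h}}) (eps X : R) : Prop :=
  forall (n : nat) (E : {set {set 'I_n}}), graph_wf E ->
  (forall E' : {set {set 'I_n}}, E' \subset E -> Hfree EH E' ->
      eps * (n ^ 2)%:R <= #|E :\: E'|%:R) ->
  (n ^ h)%:R <= X * (copies EH E)%:R.

End Defs.

(* Main.v *)
Require Import Defs.
From HB Require Import structures.
From mathcomp Require Import all_boot all_order all_algebra.
From mathcomp Require Import reals exp.
From mathcomp Require Import ring lra zify.
Import Order.TTheory GRing.Theory Num.Theory.
Local Open Scope ring_scope.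
Set Implicit Arguments. Unset Strict Implicit. Unset Printing Implicit Defensive.

(** Let G be far from H-free and let E1 be the union of a maximal family of
edge-disjoint copies of H in G. Then E1 has at least eps n^2 edges, and a constant
fraction of them must be deleted to make it H-free; this is why changing a small
constant fraction of the edges is harmless. Change E1 into E2 having a regular
equipartition Q, and keep the edges of E1 and E2 lying between distinct parts that
form a regular pair of E2, not too sparse, in which all but a small constant
fraction of the edges of E2 belong to E1. Few edges of E1 are lost, so a copy of H
survives and designates h parts of Q. The counting lemma finds many copies of H
in E2 on these parts. The added edges of E2 outside E1 are a small fraction of each
pair, and by Cauchy-Schwarz and the counting lemma for copies of H glued along an
edge they are contained in at most half of these copies; the other copies lie in G. *)

(** * Counting lemma *)

Section Box.
Variables (I V : finType) (c : I -> {set V}).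

Definition box : {set {ffun I -> V}} :=
  [set x : {ffun I -> V} | [forall i, x i \in c i]].

Lemma boxP (x : {ffun I -> V}) : reflect (forall i, x i \in c i) (x \in box).
Proof. by rewrite inE; apply: forallP. Qed.

Lemma card_box : #|box| = (\prod_i #|c i|)%N.
Proof.
have -> : #|box| = #|(family (fun i => mem (c i)) : simpl_pred {ffun I -> V})|.
  by apply: eq_card => x; rewrite inE.
by rewrite card_family foldrE big_map big_enum.
Qed.

Definition upd (x : {ffun I -> V}) (i : I) (u : V) : {ffun I -> V} :=
  [ffun k => if k == i then u else x k].

Lemma upd_box x i u : x \in box -> u \in c i -> upd x i u \in box.
Proof. by move=> /boxP xc uc; apply/boxP=> k; rewrite ffunE; case: eqP => [->|]. Qed.

(** Exchanging the coordinate [x i] with the independent value [u] is an involution on the pairs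
    [(x, u)], so resampling one coordinate does not change the average. *)
Lemma sum_upd (R : pzRingType) (g : {ffun I -> V} -> R) (i : I) :
  #|c i|%:R * (\sum_(x in box) g x) = \sum_(x in box) \sum_(u in c i) g (upd x i u).
Proof.
have -> : #|c i|%:R * (\sum_(x in box) g x) = \sum_(x in box) \sum_(u in c i) g x.
  rewrite mulr_sumr; apply: eq_bigr => x _.
  by rewrite sumr_const mulr_natl.
rewrite !pair_big_dep /=.
pose h (p : {ffun I -> V} * V) := (upd p.1 i p.2, p.1 i).
have hK : involutive h.
  case=> x u; rewrite /h /= ffunE eqxx; congr pair.
  by apply/ffunP=> k; rewrite !ffunE; case: eqP => // ->.
rewrite (reindex_inj (inv_inj hK)) /=.
apply: eq_bigl => -[x u] /=; apply/idP/idP.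
  case/andP=> /boxP xc xi; apply/andP; split; last first.
    by have := xc i; rewrite ffunE eqxx.
  apply/boxP=> k; have := xc k; rewrite ffunE; case: (k =P i) => // -> _ //.
by case/andP=> xb uc; rewrite upd_box //=; move/boxP: xb; apply.
Qed.

End Box.

Section BoxSum.
Variables (I J V : finType).

Definition joinf (x : {ffun I -> V}) (y : {ffun J -> V}) : {ffun I + J -> V} :=
  [ffun k => match k with inl a => x a | inr b => y b end].

Lemma sum_box_join (R : nmodType) (c : I + J -> {set V}) (g : {ffun I + J -> V} -> R) :
  \sum_(w in box c) g w =
  \sum_(x in box (c \o inl)) \sum_(y in box (c \o inr)) g (joinf x y).
Proof.
rewrite pair_big_dep /=.
pose p (w : {ffun I + J -> V}) := ([ffun a => w (inl a)], [ffun b => w (inr b)]).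
rewrite (reindex_onto (fun q => joinf q.1 q.2) p) /=; last first.
  by move=> w _; apply/ffunP=> -[a|b]; rewrite !ffunE.
apply: eq_bigl => -[x y] /=.
have -> : p (joinf x y) == (x, y).
  by apply/eqP; congr pair; apply/ffunP=> k; rewrite !ffunE.
rewrite andbT; apply/boxP/andP => [wc|[/boxP xc /boxP yc]].
  by split; apply/boxP=> k; [have := wc (inl k)|have := wc (inr k)]; rewrite ffunE.
by case=> k; rewrite ffunE; [apply: xc|apply: yc].
Qed.

End BoxSum.

Section Counting.
Variables (R : realFieldType) (I V : finType) (e : rel V).
Variables (c : I -> {set V}) (d : I * I -> R) (eta : R).
Hypothesis c_gt0 : forall i, (0 < #|c i|)%N.

Definition is_hom (x : {ffun I -> V}) (s : seq (I * I)) :=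
  all (fun p => e (x p.1) (x p.2)) s.

(** This is the cut-norm form of regularity: the error is measured against the whole pair, so [A]
    and [B] may be arbitrarily small. *)
Definition discrepancy_le (p : I * I) : Prop :=
  forall A B : {set V}, A \subset c p.1 -> B \subset c p.2 ->
  `| \sum_(u in A) \sum_(v in B) ((e u v)%:R - d p) | <= eta * (#|c p.1| * #|c p.2|)%:R.

(** For [p] with distinct entries this says that [p] and [q] differ as unordered pairs. *)
Definition nonparallel (p q : I * I) :=
  ~~ ((p.1 \in [:: q.1; q.2]) && (p.2 \in [:: q.1; q.2])).

Lemma hom_upd_notin x s i u :
  all (fun q => i \notin [:: q.1; q.2]) s -> is_hom (upd x i u) s = is_hom x s.
Proof.
move=> /allP si; apply: eq_in_all => q /si.
by rewrite !inE negb_or => /andP[/negPf i1 /negPf i2]; rewrite !ffunE ![_ == i]eq_sym i1 i2.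
Qed.

(** Fix all coordinates except those at [p.1] and [p.2]. No pair of [s] contains both, so the
    constraints of [s] split into one on each of the two free vertices. Their indicator is that of a
    product [A] x [B], to which the discrepancy bound applies; [sum_upd] then averages over the
    fixed coordinates. *)
Lemma discrepancy_hom (p : I * I) s :
  p.1 != p.2 -> discrepancy_le p -> all (nonparallel p) s ->
  `| \sum_(x in box c) ((e (x p.1) (x p.2))%:R - d p) * (is_hom x s)%:R |
    <= eta * #|box c|%:R.
Proof.
case: p => i j /= neij dp sp.
pose sa := [seq q <- s | j \notin [:: q.1; q.2]].
pose sb := [seq q <- s | j \in [:: q.1; q.2]].
have homE x : is_hom x s = is_hom x sa && is_hom x sb.
  rewrite /is_hom !all_filter -all_predI; apply: eq_all => q /=.
  by case: (j \in _) => //=; rewrite ?andbT.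
have sbi : all (fun q => i \notin [:: q.1; q.2]) sb.
  rewrite all_filter; apply: sub_all sp => q; rewrite /nonparallel negb_and /=.
  by case/orP=> [iq|/negPf->] //; apply/implyP.
have saj : all (fun q => j \notin [:: q.1; q.2]) sa by exact: filter_all.
have key x : x \in box c ->
  `| \sum_(u in c i) \sum_(v in c j)
      ((e (upd (upd x i u) j v i) (upd (upd x i u) j v j))%:R - d (i, j)) *
      (is_hom (upd (upd x i u) j v) s)%:R | <= eta * (#|c i| * #|c j|)%:R.
  move=> _.
  pose A := [set u in c i | is_hom (upd x i u) sa].
  pose B := [set v in c j | is_hom (upd x j v) sb].
  have := dp A B.
  rewrite /A /B /= !setIdE !subsetIl => /(_ isT isT); congr (_ <= _).
  congr (`| _ |); rewrite -!setIdE.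
  rewrite (eq_bigl (fun u => (u \in c i) && is_hom (upd x i u) sa)); last by move=> u; rewrite inE.
  rewrite big_mkcondr /=; apply: eq_bigr => u uc.
  rewrite (eq_bigl (fun v => (v \in c j) && is_hom (upd x j v) sb)); last by move=> v; rewrite inE.
  rewrite [X in if _ then X else _]big_mkcondr /=.
  have hE v : is_hom (upd (upd x i u) j v) s = is_hom (upd x i u) sa && is_hom (upd x j v) sb.
    rewrite homE (hom_upd_notin _ _ saj); congr andb.
    have -> : upd (upd x i u) j v = upd (upd x j v) i u.
      apply/ffunP=> k; rewrite !ffunE; case: (k =P j) => [->|//].
      by rewrite eq_sym (negPf neij).
    exact: hom_upd_notin.
  case: ifP => hA; last first.
    by rewrite big1 // => v _; rewrite hE hA mulr0.
  apply: eq_bigr => v vc; rewrite hE hA /= !ffunE eqxx (negPf neij) eqxx.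
  by case: (is_hom _ sb); rewrite ?mulr1 ?mulr0.
have cpos : 0 < (#|c i| * #|c j|)%:R :> R by rewrite ltr0n muln_gt0 !c_gt0.
rewrite -(ler_pM2l cpos) -{1}(ger0_norm (ltW cpos)) -normrM.
rewrite natrM -mulrA sum_upd sum_upd.
apply: le_trans (ler_norm_sum _ _ _) _.
apply: le_trans (ler_sum _ key) _.
rewrite sumr_const -mulr_natr natrM; lra.
Qed.

(** Edges are replaced by their densities one at a time. Each replacement costs [eta] by
    [discrepancy_hom], and the error already accumulated is multiplied by a density at most 1. *)
Lemma counting (s : seq (I * I)) :
  all (fun p => p.1 != p.2) s -> pairwise nonparallel s ->
  {in s, forall p, discrepancy_le p} -> {in s, forall p, 0 <= d p <= 1} ->
  `| \sum_(x in box c) (is_hom x s)%:R - (\prod_(p <- s) d p) * #|box c|%:R |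
    <= (size s)%:R * eta * #|box c|%:R.
Proof.
elim: s => [|p s IH] /=.
  move=> _ _ _ _; rewrite big_nil mul1r !mul0r.
  by rewrite sumr_const subrr normr0.
case/andP=> nep nes /andP[cp cs] ds d01.
have {}IH := IH nes cs (fun q qs => ds q (mem_behead (s := p :: s) qs))
                    (fun q qs => d01 q (mem_behead (s := p :: s) qs)).
have /andP[dp0 dp1] := d01 p (mem_head _ _).
have st := discrepancy_hom nep (ds p (mem_head _ _)) cp.
rewrite big_cons.
set T := \sum_(x in box c) (is_hom x s)%:R in IH.
set W := \sum_(x in box c) _ in st.
have -> : \sum_(x in box c) (is_hom x (p :: s))%:R = W + d p * T.
  rewrite /W /T mulr_sumr -big_split /=; apply: eq_bigr => x _.
  by case: (e _ _); case: (is_hom x s); rewrite /=; ring.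
have -> : W + d p * T - d p * \prod_(j <- s) d j * #|box c|%:R =
   W + d p * (T - \prod_(j <- s) d j * #|box c|%:R) by ring.
apply: le_trans (ler_normD _ _) _.
rewrite normrM (ger0_norm dp0) -natr1 2!mulrDl mul1r addrC.
apply: lerD => //; apply: le_trans IH; rewrite -[leRHS]mul1r.
by rewrite ler_wpM2r.
Qed.

End Counting.

(** * Copies using few edges *)

Section SecondMoment.
Variables (R : realFieldType) (I V : finType) (e f : rel V).
Variables (c : I -> {set V}) (d : I * I -> R) (eta g : R).
Hypothesis c_gt0 : forall i, (0 < #|c i|)%N.

Local Notation N := (#|box c|%:R : R).

Lemma box_gt0 : 0 < N.
Proof. by rewrite card_box ltr0n prodn_gt0. Qed.

Lemma sum_box_pair (F : V -> V -> R) (i j : I) : i != j ->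
  (#|c i| * #|c j|)%:R * (\sum_(x in box c) F (x i) (x j)) =
  N * \sum_(u in c i) \sum_(v in c j) F u v.
Proof.
move=> neij; rewrite natrM -mulrA sum_upd sum_upd.
rewrite mulr_natl -sumr_const; apply: eq_bigr => x _.
apply: eq_bigr => u _; apply: eq_bigr => v _.
by rewrite !ffunE eqxx (negPf neij) eqxx.
Qed.

Variables (i j : I).

Definition mix (x y : {ffun I -> V}) : {ffun I -> V} :=
  [ffun k => if k \in [:: i; j] then x k else y k].

Lemma mix_box x y : x \in box c -> y \in box c -> mix x y \in box c.
Proof.
by move=> /boxP xc /boxP yc; apply/boxP => k; rewrite ffunE; case: ifP.
Qed.

(** Swapping the coordinates [i] and [j] between two independent points is an involution on pairs of
    points. Hence [G] may be averaged over all extensions of the fixed endpoints [x i] and [x j]. *)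
Lemma sum_mix (F : V -> V -> R) (G : {ffun I -> V} -> R) :
  N * (\sum_(x in box c) F (x i) (x j) * G x) =
  \sum_(x in box c) F (x i) (x j) * \sum_(y in box c) G (mix x y).
Proof.
have -> : N * (\sum_(x in box c) F (x i) (x j) * G x) =
  \sum_(x in box c) \sum_(y in box c) F (y i) (y j) * G y.
  by rewrite sumr_const mulr_natl.
under [RHS]eq_bigr do rewrite mulr_sumr.
rewrite !pair_big /=.
pose sw (p : {ffun I -> V} * {ffun I -> V}) := (mix p.2 p.1, mix p.1 p.2).
have swK : involutive sw.
  by case=> x y; congr pair; apply/ffunP=> k; rewrite !ffunE; case: (k \in _).
rewrite (reindex_inj (inv_inj swK)) /=; apply: eq_big => [[x y]|[x y] _] /=.
  apply/andP/andP => [[xb yb]|[xb yb]]; last by rewrite !mix_box.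
  have [] := (mix_box yb xb, mix_box xb yb).
  have -> : mix (mix x y) (mix y x) = x by have [] := swK (x, y).
  by have -> : mix (mix y x) (mix x y) = y by have [] := swK (x, y).
by rewrite !ffunE !inE !eqxx orbT.
Qed.

Let K : finType := (I + (I + I))%type.
Let proj (k : K) : I :=
  match k with inl a => a | inr (inl a) => a | inr (inr a) => a end.
Let r1 (k : I) : K := if k \in [:: i; j] then inl k else inr (inl k).
Let r2 (k : I) : K := if k \in [:: i; j] then inl k else inr (inr k).

Let r1K : cancel r1 proj. Proof. by move=> k; rewrite /r1; case: ifP. Qed.
Let r2K : cancel r2 proj. Proof. by move=> k; rewrite /r2; case: ifP. Qed.

Let mp (r : I -> K) (q : I * I) := (r q.1, r q.2).

(* Three copies of the vertex set; the copies [r1] and [r2] of the edges in [s0]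
   share exactly the two endpoints of the edge [(i, j)], which comes first. *)
Let glued (s0 : seq (I * I)) :=
  (inl i, inl j) :: [seq mp r1 q | q <- s0] ++ [seq mp r2 q | q <- s0].

Let hom_join x y z s0 :
  is_hom e (joinf x (joinf y z)) (glued s0) =
  [&& e (x i) (x j), is_hom e (mix x y) s0 & is_hom e (mix x z) s0].
Proof.
rewrite /is_hom /= all_cat !all_map !ffunE; congr [&& _, _ & _]; apply: eq_all => q /=;
  by rewrite !ffunE /r1 /r2; do 2![case: ifP => _]; rewrite ?ffunE.
Qed.

Let nonparallel_inj (r : I -> K) q q' : injective r ->
  nonparallel (mp r q) (mp r q') = nonparallel q q'.
Proof. by move=> ri; rewrite /nonparallel !inE /= !(inj_eq ri). Qed.

(** The two copies share only the vertices [i] and [j], so an edge of one copy parallel to an edge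
    of the other would join [i] to [j]. This is excluded because no edge of [s0] is parallel to
    [(i, j)]. *)
Let glued_nonparallel s0 : all (fun q => q.1 != q.2) s0 ->
  pairwise (@nonparallel I) ((i, j) :: s0) -> pairwise (@nonparallel K) (glued s0).
Proof.
move=> ne0 /= /andP[/allP cij c0].
have crossr (r : I -> K) : cancel r proj ->
   all (nonparallel (inl i, inl j)) [seq mp r q | q <- s0].
  move=> rK; rewrite all_map; apply/allP => q /cij; apply: contra.
  rewrite !inE /= => /andP[h1 h2]; apply/andP; split.
    by case/orP: h1 => /eqP h; have := congr1 proj h; rewrite rK => /= ->; rewrite eqxx ?orbT.
  by case/orP: h2 => /eqP h; have := congr1 proj h; rewrite rK => /= ->; rewrite eqxx ?orbT.
rewrite all_cat !crossr //=.
rewrite pairwise_cat !pairwise_map; apply/and3P; split; last first.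
- by apply: sub_pairwise c0 => q q'; rewrite /= (nonparallel_inj _ _ (can_inj r2K)).
- by apply: sub_pairwise c0 => q q'; rewrite /= (nonparallel_inj _ _ (can_inj r1K)).
apply/allrelP => _ _ /mapP[q qs ->] /mapP[q' qs' ->].
rewrite /nonparallel; apply/negP => /andP[h1 h2].
have aux k l m : r1 k \in [:: r2 l; r2 m] -> k \in [:: i; j].
  by rewrite /r1; case: ifP => // _; rewrite !inE /r2; case: ifP => _; case: ifP.
have q1 := aux _ _ _ h1; have q2 := aux _ _ _ h2.
have := cij _ qs; rewrite /nonparallel.
have := allP ne0 _ qs; rewrite !inE /= in q1 q2 *.
by case/orP: q1 => /eqP ->; case/orP: q2 => /eqP ->; rewrite ?eqxx ?orbT.
Qed.

(* Cauchy-Schwarz in the form [2ab <= a^2 + b^2]: a set of few edges [f] can only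
   carry many copies if the number of copies per edge has a large second moment,
   and that moment counts the copies of the glued graph. *)
Lemma sum_sparse_edges_le (s0 : seq (I * I)) (D0 := \prod_(q <- s0) d q) :
  i != j -> all (fun q => q.1 != q.2) s0 ->
  pairwise (@nonparallel I) ((i, j) :: s0) ->
  {in (i, j) :: s0, forall p, discrepancy_le e c d eta p} ->
  {in (i, j) :: s0, forall p, 0 <= d p <= 1} ->
  (2 * size s0).+1%:R * eta <= d (i, j) * D0 ^+ 2 ->
  0 < D0 -> 0 < g -> subrel f e ->
  \sum_(u in c i) \sum_(v in c j) (f u v)%:R
    <= g ^+ 2 * d (i, j) * (#|c i| * #|c j|)%:R ->
  \sum_(x in box c) (f (x i) (x j) && is_hom e x s0)%:R
    <= 2 * g * (d (i, j) * D0) * N.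
Proof.
move=> neij ne0 cr ds d01 etaD D0gt g0 fe fsmall.
have Ngt := box_gt0.
pose phi x : R := \sum_(y in box c) (is_hom e (mix x y) s0)%:R.
have d0 : 0 <= d (i, j) by case/andP: (d01 _ (mem_head _ _)).
have Lf : \sum_(x in box c) (f (x i) (x j))%:R <= N * (g ^+ 2 * d (i, j)).
  have cij : 0 < (#|c i| * #|c j|)%:R :> R by rewrite ltr0n muln_gt0 !c_gt0.
  rewrite -(ler_pM2l cij) (sum_box_pair (fun u v => (f u v)%:R) neij).
  by rewrite [leRHS]mulrCA ler_pM2l // mulrC.
(* The sum counts copies of the glued graph: the main term is [d (i, j) * D0 ^+ 2 * N ^+ 3], and the
   assumption on [eta] makes the error no larger, whence the factor 2. *)
have Le : \sum_(x in box c) (e (x i) (x j))%:R * phi x ^+ 2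
    <= 2 * (d (i, j) * D0 ^+ 2) * N ^+ 3.
  have cgt k : (0 < #|(c \o proj) k|)%N by apply: c_gt0.
  have neG : all (fun q => q.1 != q.2) (glued s0).
    rewrite /= all_cat !all_map /=; apply/and3P; split; first by rewrite (inj_eq inl_inj).
      by apply: sub_all ne0 => q; rewrite /= (inj_eq (can_inj r1K)).
    by apply: sub_all ne0 => q; rewrite /= (inj_eq (can_inj r2K)).
  have inG q : q \in glued s0 -> (proj q.1, proj q.2) \in (i, j) :: s0.
    rewrite !inE mem_cat => /orP[/eqP-> /=|]; first by rewrite eqxx.
    by case/orP => /mapP[[a b] qs ->] /=; rewrite ?r1K ?r2K qs orbT.
  pose d3 (q : K * K) := d (proj q.1, proj q.2).
  have dG : {in glued s0, forall p, discrepancy_le e (c \o proj) d3 eta p}.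
    by move=> p /inG /ds; apply.
  have dG01 : {in glued s0, forall p, 0 <= d3 p <= 1} by move=> p /inG /d01.
  have := counting cgt neG (glued_nonparallel ne0 cr) dG dG01.
  have -> : \prod_(p <- glued s0) d3 p = d (i, j) * D0 ^+ 2.
    rewrite big_cons big_cat !big_map /= /d3 /= expr2 /D0; congr (_ * (_ * _));
    by apply: eq_bigr => -[a b] _ /=; rewrite ?r1K ?r2K.
  (* Coordinates of the three vertex sets that the glued graph does not touch range freely, so the
     total is the full cube. *)
  have -> : #|box (c \o proj)|%:R = N ^+ 3.
    rewrite -natrX !card_box big_sumType big_sumType /=.
    by rewrite 2!expnS expn1.
  have -> : (size (glued s0))%:R = (2 * size s0).+1%:R :> R.
    by rewrite /= size_cat !size_map mul2n addnn.
  rewrite sum_box_join.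
  under eq_bigr do rewrite sum_box_join.
  have -> : \sum_(x in box ((c \o proj) \o inl))
     \sum_(y in box (((c \o proj) \o inr) \o inl))
     \sum_(z in box (((c \o proj) \o inr) \o inr))
       (is_hom e (joinf x (joinf y z)) (glued s0))%:R =
     \sum_(x in box c) (e (x i) (x j))%:R * phi x ^+ 2.
    apply: eq_bigr => x _; rewrite expr2 /phi mulr_suml mulr_sumr.
    apply: eq_bigr => y _; rewrite !mulr_sumr.
    apply: eq_bigr => z _; rewrite hom_join.
    by case: (e _ _); case: (is_hom e (mix x y) _); case: (is_hom e (mix x z) _);
      rewrite /= ?(mulr0, mul0r, mulr1).
  move=> /(le_trans (ler_norm _)); rewrite lerBlDl => /le_trans; apply.
  rewrite -mulrDl ler_pM2r ?exprn_gt0 //; lra.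
have mixE := sum_mix (fun u v => (f u v)%:R) (fun x => (is_hom e x s0)%:R).
set T := \sum_(x in box c) ((f (x i) (x j))%:R * (is_hom e x s0)%:R) in mixE.
have TE : \sum_(x in box c) (f (x i) (x j) && is_hom e x s0)%:R = T.
  by apply: eq_bigr => x _; case: (f _ _) => /=; rewrite ?mul1r ?mul0r.
rewrite TE.
(* For each [x] whose pair lies in [f], take a = [D0 * N] and b = [g * phi x]. Since [f] is
   contained in [e], the sum of the b^2 extends to all edges of [e]. The factor [g] makes both sums
   of order [g ^+ 2 * d (i, j) * D0 ^+ 2 * N ^+ 3]. *)
have amgm : 2 * (D0 * N) * g * (N * T) <=
   (D0 * N) ^+ 2 * (\sum_(x in box c) (f (x i) (x j))%:R) +
   g ^+ 2 * (\sum_(x in box c) (e (x i) (x j))%:R * phi x ^+ 2).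
  rewrite mixE !mulr_sumr -big_split /=; apply: ler_sum => x _.
  case fx: (f _ _); last first.
    rewrite mul0r !mulr0 add0r.
    exact: mulr_ge0 (sqr_ge0 _) (mulr_ge0 (ler0n _ _) (sqr_ge0 _)).
  rewrite (fe _ _ fx) !mul1r mulr1 -/(phi x).
  have := sqr_ge0 (D0 * N - g * phi x); nra.
have b1 : (D0 * N) ^+ 2 * (\sum_(x in box c) (f (x i) (x j))%:R) <=
   (D0 * N) ^+ 2 * (N * (g ^+ 2 * d (i, j))) by rewrite ler_wpM2l // sqr_ge0.
have b2 := ler_wpM2l (sqr_ge0 g) Le.
have pos : 0 < 2 * (D0 * N) * g * N by rewrite !mulr_gt0.
rewrite -(ler_pM2l pos) -[leLHS]mulrA; apply: le_trans amgm _.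
apply: le_trans (lerD b1 b2) _.
have -> : 2 * (D0 * N) * g * N * (2 * g * (d (i, j) * D0) * N) =
  4 * (d (i, j) * (g ^+ 2 * D0 ^+ 2 * N ^+ 3)) by ring.
have -> : (D0 * N) ^+ 2 * (N * (g ^+ 2 * d (i, j))) +
    g ^+ 2 * (2 * (d (i, j) * D0 ^+ 2) * N ^+ 3) =
  3 * (d (i, j) * (g ^+ 2 * D0 ^+ 2 * N ^+ 3)) by ring.
rewrite ler_wpM2r ?ler_nat // mulr_ge0 // !mulr_ge0 ?exprn_ge0 // ltW //.
Qed.

End SecondMoment.

(** * Copies avoiding a sparse set of edges *)

Section CleanCopies.
Variables (R : realFieldType) (I V : finType) (e f : rel V).
Variables (c : I -> {set V}) (d : I * I -> R) (eta tau : R) (L : nat).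
Hypothesis c_gt0 : forall i, (0 < #|c i|)%N.
Hypothesis eta_ge0 : 0 <= eta.
Hypothesis tau01 : 0 < tau <= 1.
Hypothesis L_gt0 : (0 < L)%N.
Hypothesis eta_small : (2 * L).+1%:R * eta <= tau ^+ (2 * L).

Lemma prod_ge_expn (s : seq (I * I)) :
  {in s, forall p, tau <= d p <= 1} -> (size s <= L)%N ->
  tau ^+ L <= \prod_(q <- s) d q <= 1.
Proof.
case/andP: tau01 => t0 t1 ds sL.
have : tau ^+ size s <= \prod_(q <- s) d q <= 1.
  elim: s ds {sL} => [|p s IH] ds; first by rewrite big_nil /= lexx.
  have /andP[h1 h2] := IH (fun q qs => ds q (mem_behead (s := p :: s) qs)).
  have /andP[h3 h4] := ds p (mem_head _ _).
  have t0' := ltW t0; have d0 := le_trans t0' h3.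
  rewrite big_cons exprS ler_pM ?exprn_ge0 //= mulr_ile1 //.
  by apply: le_trans h1; rewrite exprn_ge0.
case/andP=> h ->; rewrite andbT; apply: le_trans h.
by apply: ler_wiXn2l => //; apply: ltW.
Qed.

(** With D the product of the densities, counting gives at least D N / 2 copies in [e]. For each of
    the at most [L] pairs of [s], at most 2 g D N = D N / (4 L) copies place that pair in [f], where
    g = 1 / (8 L). At least D N / 4 copies remain. *)
Lemma clean_copies (s : seq (I * I)) :
  all (fun q => q.1 != q.2) s -> uniq s ->
  {in s &, forall p q, p != q -> nonparallel p q} ->
  (size s <= L)%N ->
  {in s, forall p, discrepancy_le e c d eta p} ->
  {in s, forall p, tau <= d p <= 1} ->
  subrel f e ->
  {in s, forall p, \sum_(u in c p.1) \sum_(v in c p.2) (f u v)%:R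
    <= ((8 * L)%:R^-1) ^+ 2 * d p * (#|c p.1| * #|c p.2|)%:R} ->
  tau ^+ L / 4 * #|box c|%:R <=
    \sum_(x in box c) (is_hom (fun u v => e u v && ~~ f u v) x s)%:R.
Proof.
move=> nes us crs sL dis ds fe fs.
have [t0 t1] := andP tau01.
have tL0 : 0 < tau ^+ L by rewrite exprn_gt0.
set N : R := #|box c|%:R.
have Ngt : 0 < N := box_gt0 R c_gt0.
pose D := \prod_(q <- s) d q.
have /andP[DL D1] : tau ^+ L <= D <= 1 by apply: prod_ge_expn.
have D0 : 0 < D by apply: lt_le_trans DL.
pose g : R := (8 * L)%:R^-1.
have g0 : 0 < g by rewrite invr_gt0 ltr0n muln_gt0.
have gL : 8 * g * L%:R = 1.
  by rewrite /g natrM invfM mulrA divff ?pnatr_eq0 // mul1r mulVf // pnatr_eq0 -lt0n.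
have DD : tau ^+ (2 * L) <= D * tau ^+ L.
  by rewrite mul2n -addnn exprD ler_pM2r.
have pw s' : uniq s' -> {subset s' <= s} -> pairwise (@nonparallel I) s'.
  move=> us' ss'; rewrite uniq_pairwise in us'.
  apply: (sub_in_pairwise (P := mem s)) us' => [p q ps qs /=|]; first exact: crs.
  by apply/allP.
have d01 : {in s, forall p, 0 <= d p <= 1}.
  by move=> p /ds /andP[h ->]; rewrite (le_trans (ltW t0) h).
pose T p : R := \sum_(x in box c) (f (x p.1) (x p.2) && is_hom e x (rem p s))%:R.
have Tle p : p \in s -> T p <= 2 * g * D * N.
  case: p => i j ps.
  have perm := perm_to_rem ps.
  have mem_r q : q \in (i, j) :: rem (i, j) s -> q \in s by rewrite -(perm_mem perm).
  have Dperm : D = d (i, j) * \prod_(q <- rem (i, j) s) d q.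
    by rewrite /D (perm_big _ perm) big_cons.
  have /andP[r1 r2] : tau ^+ L <= \prod_(q <- rem (i, j) s) d q <= 1.
    apply: prod_ge_expn => [q qs|]; first by apply: ds; apply: mem_rem qs.
    by rewrite size_rem //; apply: leq_trans (leq_pred _) sL.
  rewrite Dperm; apply: (@sum_sparse_edges_le R I V e f c d eta g) => //.
  - exact: (allP nes _ ps).
  - by apply/allP => q /mem_rem /(allP nes).
  - by apply: pw; [rewrite -(perm_uniq perm)|].
  - by move=> q /mem_r /dis.
  - by move=> q /mem_r /d01.
  - apply: le_trans (_ : (2 * L).+1%:R * eta <= _).
      rewrite ler_wpM2r // ler_nat ltnS leq_pmul2l // size_rem //.
      by apply: leq_trans (leq_pred _) sL.
    apply: le_trans eta_small _; apply: le_trans DD _.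
    by rewrite expr2 mulrA -Dperm ler_wpM2l // ltW.
  - exact: lt_le_trans r1.
  - exact: fs.
have hom_ge := counting c_gt0 nes (pw s us (fun _ => id)) dis d01.
rewrite -/D -/N in hom_ge.
have {}hom_ge : D * N / 2 <= \sum_(x in box c) (is_hom e x s)%:R.
  have etaL : (size s)%:R * eta <= D / 2.
    have h1 : (size s)%:R * eta <= L%:R * eta by rewrite ler_wpM2r // ler_nat.
    have h2 : (2 * L).+1%:R * eta = 2 * (L%:R * eta) + eta.
      by rewrite -natr1 natrM; ring.
    have h3 : tau ^+ L <= 1 by rewrite exprn_ile1 // ltW.
    have h4 : D * tau ^+ L <= D by rewrite ger_pMr.
    move: eta_small; rewrite h2; move: DD h1 h4 eta_ge0; lra.
  have := ler_wpM2r (ltW Ngt) etaL.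
  move/(le_trans hom_ge); rewrite ler_norml => /andP[+ _]; lra.
(* Union bound: a copy that meets [f] is charged to a pair of [s] that it places in [f]. *)
have point x : (is_hom e x s)%:R <=
    (is_hom (fun u v => e u v && ~~ f u v) x s)%:R +
    \sum_(p <- s) (f (x p.1) (x p.2) && is_hom e x (rem p s))%:R :> R.
  case hx : (is_hom e x s); last by rewrite addr_ge0 ?ler0n // sumr_ge0 // => p _; rewrite ler0n.
  case: (boolP (has (fun p => f (x p.1) (x p.2)) s)) => [/hasP[p ps fp]|nf].
    rewrite (big_rem p) //= fp /=.
    have -> : is_hom e x (rem p s).
      by apply/allP => q /mem_rem qs; exact: (allP hx).
    have : 0 <= \sum_(q <- rem p s) (f (x q.1) (x q.2) && is_hom e x (rem q s))%:R :> R.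
      by rewrite sumr_ge0 // => q _; rewrite ler0n.
    have : 0 <= (is_hom (fun u v => e u v && ~~ f u v) x s)%:R :> R by rewrite ler0n.
    rewrite /=; lra.
  have -> : is_hom (fun u v => e u v && ~~ f u v) x s.
    rewrite -all_predC in nf; apply/allP => p ps.
    by have := allP hx p ps => /= ->; apply: (allP nf).
  by rewrite lerDl sumr_ge0 // => q _; rewrite ler0n.
have tot : \sum_(x in box c) (is_hom e x s)%:R <=
  \sum_(x in box c) (is_hom (fun u v => e u v && ~~ f u v) x s)%:R + \sum_(p <- s) T p.
  rewrite /T exchange_big /= -big_split /=; apply: ler_sum => x _; exact: point.
have bad : \sum_(p <- s) T p <= D * N / 4.
  apply: le_trans (_ : \sum_(p <- s) (2 * g * D * N) <= _).
    by rewrite big_seq [leRHS]big_seq; apply: ler_sum => p; apply: Tle.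
  rewrite big_const_seq count_predT iter_addr_0 -[leLHS]mulr_natr.
  apply: le_trans (_ : 2 * g * D * N * L%:R <= _).
    by rewrite ler_wpM2l ?ler_nat // !mulr_ge0 // ltW.
  have -> : 2 * g * D * N * L%:R = (8 * g * L%:R) * (D * N / 4) by field.
  by rewrite gL mul1r.
have := ler_wpM2r (ltW Ngt) DL.
move: hom_ge tot bad; lra.
Qed.

End CleanCopies.

(** * Graphs and equipartitions *)

Section Embeddings.
Variables (h n : nat) (EH : {set {set 'I_h}}).
Implicit Types (E : {set {set 'I_n}}) (f : {ffun 'I_h -> 'I_n}).

Lemma embeddingsP E f :
  reflect (injective f /\ {in EH, forall e : {set 'I_h}, f @: e \in E})
          (f \in embeddings EH E).
Proof.
rewrite inE; apply: (iffP andP) => [[/injectiveP fi /forall_inP fE]|[fi fE]].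
  by split=> // e eH; apply: fE.
by split; [apply/injectiveP | apply/forall_inP].
Qed.

Lemma HfreeS E E' : E' \subset E -> Hfree EH E -> Hfree EH E'.
Proof.
move=> /subsetP sE /eqP E0; rewrite /Hfree -subset0 -E0; apply/subsetP => f.
by case/embeddingsP => fi fE; apply/embeddingsP; split=> // e /fE /sE.
Qed.

(* [E1] is the union of a maximal family of edge-disjoint copies. *)
Lemma exists_far_subgraph (L : nat) E : EH != set0 -> (#|EH| <= L)%N ->
  exists E1 : {set {set 'I_n}}, [/\ E1 \subset E, Hfree EH (E :\: E1) &
    forall E' : {set {set 'I_n}}, E' \subset E1 -> Hfree EH E' ->
      (#|E1| <= L * #|E1 :\: E'|)%N].
Proof.
move=> EH0 cL; have [k] := ubnP #|E|; elim: k E => // k IH E Ek.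
have [EF|] := boolP (Hfree EH E).
  exists set0; split; rewrite ?sub0set ?setD0 // => E' _ _.
  by rewrite cards0.
case/set0Pn => f /embeddingsP[fi fE].
pose K := [set f @: e | e : {set 'I_h} in EH].
have sK : K \subset E by apply/subsetP => _ /imsetP[e eH ->]; apply: fE.
have K0 : K != set0.
  by case/set0Pn: EH0 => e eH; apply/set0Pn; exists (f @: e); apply: imset_f.
have cK : (#|K| <= L)%N by apply: leq_trans (leq_imset_card _ _) cL.
have [|E1 [sE1 F1 far1]] := IH (E :\: K).
  rewrite -(cardsID K E) (setIidPr sK) in Ek; rewrite -card_gt0 in K0.
  by move: Ek; rewrite ltnS; apply: leq_trans; rewrite -[X in (X < _)%N]add0n ltn_add2r.
have dK : [disjoint E1 & K].
  by rewrite disjoints_subset; apply: subset_trans sE1 _; rewrite setDE subsetIr.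
exists (E1 :|: K); split.
- by rewrite subUset sK andbT; apply: subset_trans sE1 (subsetDl _ _).
- by rewrite setUC -setDDl.
move=> E' sE' F'.
have := far1 (E' :&: E1) (subsetIr _ _) (HfreeS (subsetIl _ _) F').
(* A free [E'] omits an edge of the removed copy [K]. Adding back [K] thus raises the number of
   deleted edges by at least 1 and the number of edges by at most [L], which preserves the ratio. *)
have /set0Pn[x xK] : K :\: E' != set0.
  rewrite setD_eq0; apply/negP => /subsetP KE'.
  move/eqP: F' => /setP/(_ f); rewrite [RHS]inE => /negP; apply; apply/embeddingsP.
  by split=> // e eH; apply: KE'; apply: imset_f.
have -> : #|E1 :|: K| = (#|E1| + #|K|)%N by rewrite cardsU disjoint_setI0 // cards0 subn0.
have -> : #|(E1 :|: K) :\: E'| = (#|E1 :\: E'| + #|K :\: E'|)%N.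
  rewrite setDUl cardsU disjoint_setI0 ?cards0 ?subn0 //.
  by apply: disjointWl (subsetDl _ _) _; apply: disjointWr (subsetDl _ _) _.
have -> : E1 :\: E' :&: E1 = E1 :\: E' by rewrite setDIr setDv setU0.
have : (0 < #|K :\: E'|)%N by apply/card_gt0P; exists x.
nia.
Qed.

End Embeddings.

Section Regular.
Variables (R : realType) (n : nat).
Implicit Types (E : {set {set 'I_n}}) (A B : {set 'I_n}).

Lemma eG_sum E A B :
  (eG E A B)%:R = \sum_(u in A) \sum_(v in B) (adj E u v)%:R :> R.
Proof.
rewrite /eG -sum1dep_card natr_sum big_mkcondr pair_big /=.
by apply: eq_big => [[u v]|[u v] _] /=; rewrite ?inE //; case: adj.
Qed.

Lemma eG_le E A B : (eG E A B <= #|A| * #|B|)%N.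
Proof.
rewrite -cardsX; apply: subset_leq_card; apply/subsetP => p.
by rewrite inE => /andP[].
Qed.

Lemma dG_mul E A B : dG R E A B * (#|A| * #|B|)%:R = (eG E A B)%:R.
Proof.
rewrite /dG; have [AB0|AB0] := eqVneq (#|A| * #|B|)%N 0%N.
  by have := eG_le E A B; rewrite AB0 leqn0 => /eqP ->; rewrite !mul0r.
by rewrite divfK // pnatr_eq0.
Qed.

Lemma dG_ge0 E A B : 0 <= dG R E A B.
Proof. by rewrite divr_ge0. Qed.

Lemma dG_le1 E A B : dG R E A B <= 1.
Proof.
rewrite /dG; have [AB0|AB0] := posnP (#|A| * #|B|)%N.
  by rewrite AB0 invr0 mulr0.
by rewrite ler_pdivrMr ?ltr0n // mul1r ler_nat eG_le.
Qed.

(** If one of [A'], [B'] is below the threshold of regularity, its small size pays for the trivial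
    bound 1 on the difference of densities; otherwise regularity bounds that difference by [eta]. *)
Lemma regular_discrepancy E (eta : R) A B : 0 <= eta -> regular_pair E eta A B ->
  forall A' B', A' \subset A -> B' \subset B ->
  `|\sum_(u in A') \sum_(v in B') ((adj E u v)%:R - dG R E A B)|
    <= eta * (#|A| * #|B|)%:R.
Proof.
move=> eta0 /forallP reg A' B' sA sB.
have -> : \sum_(u in A') \sum_(v in B') ((adj E u v)%:R - dG R E A B) =
  (dG R E A' B' - dG R E A B) * (#|A'| * #|B'|)%:R.
  rewrite mulrBl dG_mul eG_sum.
  under eq_bigr do rewrite sumrB.
  rewrite sumrB; congr (_ - _).
  under eq_bigr do rewrite sumr_const.
  by rewrite sumr_const -mulrnA mulr_natr mulnC.
rewrite normrM normr_nat.
have cA := subset_leq_card sA; have cB := subset_leq_card sB.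
have dle : `|dG R E A' B' - dG R E A B| <= 1.
  rewrite ler_norml; have := dG_ge0 E A B; have := dG_ge0 E A' B'.
  by have := dG_le1 E A B; have := dG_le1 E A' B'; lra.
have rA : #|A'|%:R <= #|A|%:R :> R by rewrite ler_nat.
have rB : #|B'|%:R <= #|B|%:R :> R by rewrite ler_nat.
rewrite !natrM.
have a0 : 0 <= #|A'|%:R :> R by [].
have b0 : 0 <= #|B'|%:R :> R by [].
have [lA|lA] := lerP (eta * #|A|%:R) #|A'|%:R; last first.
  apply: le_trans (_ : 1 * (#|A'|%:R * #|B'|%:R) <= _).
    by rewrite ler_wpM2r // mulr_ge0.
  by rewrite mul1r mulrA ler_pM // ltW.
have [lB|lB] := lerP (eta * #|B|%:R) #|B'|%:R; last first.
  apply: le_trans (_ : 1 * (#|A'|%:R * #|B'|%:R) <= _).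
    by rewrite ler_wpM2r // mulr_ge0.
  by rewrite mul1r mulrCA ler_pM // ltW.
have := reg A'; rewrite powersetE sA /= => /forallP /(_ B').
rewrite powersetE sB /= lA lB /= distrC => reg'.
by apply: ler_pM => //; [rewrite mulr_ge0|apply: ler_pM].
Qed.

End Regular.

(** * Part sizes and existence of equipartitions *)

Section Equipartitions.
Variable n : nat.
Implicit Types (P : {set {set 'I_n}}).

(** A part exceeds the average size by at most 1, and there are at most [n] parts since none is
    empty. *)
Lemma equipartition_upper P A : equipartition P -> A \in P ->
  (#|P| * #|A| <= 2 * n)%N.
Proof.
case/andP => pP /forall_inP eq AP.
have eqA B : B \in P -> (#|A| <= #|B| + 1)%N by move/forall_inP: (eq A AP); apply.
have cn : (\sum_(B in P) #|B| = n)%N by rewrite -(card_partition pP) cardsT card_ord.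
have kn : (#|P| <= n)%N.
  rewrite -[leqRHS]cn -sum1_card; apply: leq_sum => B BP.
  by rewrite card_gt0; apply: contraTneq BP => ->; case/and3P: pP.
apply: leq_trans (_ : n + #|P| <= _)%N; last by lia.
rewrite -[X in (_ <= X + _)%N]cn -sum_nat_const.
rewrite -[X in (_ <= _ + X)%N]sum1_card -big_split /=.
exact: leq_sum.
Qed.

Lemma equipartition_lower P A : equipartition P -> A \in P ->
  (n <= 2 * #|P| * #|A|)%N.
Proof.
case/andP => pP /forall_inP eq AP.
have cn : (\sum_(B in P) #|B| = n)%N by rewrite -(card_partition pP) cardsT card_ord.
have A0 : (0 < #|A|)%N.
  by rewrite card_gt0; apply: contraTneq AP => ->; case/and3P: pP.
apply: leq_trans (_ : #|P| * (#|A| + 1) <= _)%N; last by nia.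
rewrite -[leqLHS]cn -sum_nat_const; apply: leq_sum => B BP.
by move/forall_inP: (eq B BP); apply.
Qed.

(** The value is the ceiling of (n - r) / m; adding [m] before subtracting keeps the natural
    subtraction from truncating. *)
Lemma card_residue (m r : nat) : (r < m)%N ->
  #|[set i : 'I_n | (i %% m)%N == r]| = ((n + m - r.+1) %/ m)%N.
Proof.
move=> rm; rewrite -sum1dep_card big_mkcond /=; have m0 : (0 < m)%N by lia.
elim: n => [|k IH].
  by rewrite big_ord0 divn_small //; lia.
rewrite big_ord_recr /= IH.
have -> : (k.+1 + m - r.+1 = (k + m - r.+1).+1)%N by lia.
rewrite divnS // addnC; congr addn.
have -> : ((k + m - r.+1).+1 = k + m - r)%N by lia.
rewrite -eqn_mod_dvd; last by lia.
by rewrite modnDr (modn_small rm); case: eqP.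
Qed.

Lemma exists_equipartition (m : nat) : (0 < m <= n)%N ->
  exists2 P : {set {set 'I_n}}, equipartition P & #|P| = m.
Proof.
case/andP=> m0 mn.
pose cls (r : 'I_m) := [set i : 'I_n | (i %% m)%N == r].
have inc (r : 'I_m) : widen_ord mn r \in cls r by rewrite inE /= modn_small.
exists [set cls r | r : 'I_m]; last first.
  rewrite card_imset ?card_ord // => r r' /setP /(_ (widen_ord mn r)).
  by rewrite inc inE /= modn_small // => /esym /eqP /val_inj.
apply/andP; split.
  apply/and3P; split.
  - apply/eqP/setP => i; rewrite in_setT; apply/bigcupP.
    exists (cls (Ordinal (ltn_pmod i m0))); first exact: imset_f.
    by rewrite inE.
  - apply/trivIsetP => _ _ /imsetP[r _ ->] /imsetP[r' _ ->] neq.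
    rewrite -setI_eq0; apply/eqP/setP => i; rewrite !inE.
    by apply/negP => /andP[/eqP h1 /eqP h2]; case/negP: neq; apply/eqP;
      congr cls; apply: val_inj; rewrite /= -h1 -h2.
  by apply/imsetP => -[r _ /setP /(_ (widen_ord mn r))]; rewrite inc inE.
apply/forall_inP => _ /imsetP[r _ ->]; apply/forall_inP => _ /imsetP[r' _ ->].
rewrite !card_residue //.
apply: leq_trans (_ : (n + m - r'.+1 + m) %/ m <= _)%N.
  by apply: leq_div2r; have := ltn_ord r'; lia.
by rewrite divnDr ?dvdnn // divnn m0.
Qed.

End Equipartitions.

(** * Cleaning *)

Lemma card_ordered_pairs (T : finType) (F : {set {set T}}) :
  {in F, forall e : {set T}, #|e| = 2%N} ->
  (#|[set p : T * T | [set p.1; p.2] \in F]| <= 4 * #|F|)%N.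
Proof.
move=> F2; rewrite -sum1dep_card (partition_big (fun p => [set p.1; p.2]) (mem F)) //=.
rewrite mulnC -sum_nat_const; apply: leq_sum => e eF.
rewrite sum1dep_card; apply: leq_trans (_ : #|setX e e| <= _)%N; last first.
  by rewrite cardsX F2.
apply: subset_leq_card; apply/subsetP => p; rewrite !inE => /andP[_ /eqP <-].
by rewrite set21 set22.
Qed.

(** * Refinements and a lower bound for S *)

Section Refinement.
Variables (n : nat) (P Q : {set {set 'I_n}}).

(** Send each part of [P] to the block of [Q] around a chosen point of it. This is injective because
    a block of [Q] lies inside a single part of [P]. *)
Lemma refines_card : partition P [set: 'I_n] -> partition Q [set: 'I_n] ->
  refines Q P -> (#|P| <= #|Q|)%N.
Proof.
move=> /and3P[_ tP P0] /and3P[/eqP cQ tQ _] /forall_inP ref.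
pose rep (A : {set 'I_n}) := [pick x in A].
pose F (A : {set 'I_n}) := if rep A is Some x then pblock Q x else set0.
rewrite -(card_in_imset (f := F)) => [|A B AP BP].
  apply: subset_leq_card; apply/subsetP => _ /imsetP[A AP ->].
  rewrite /F /rep; case: pickP => [x xA|A0]; first by rewrite pblock_mem // cQ.
  by case/negP: P0; rewrite (_ : set0 = A) //; apply/setP => x; rewrite inE A0.
rewrite /F /rep; case: pickP => [x xA|A0]; last first.
  by case/negP: P0; rewrite (_ : set0 = A) //; apply/setP => x; rewrite inE A0.
case: pickP => [y yB|B0]; last first.
  by case/negP: P0; rewrite (_ : set0 = B) //; apply/setP => y; rewrite inE B0.
move=> eqxy; have xQ : x \in cover Q by rewrite cQ.
have yQ : y \in cover Q by rewrite cQ.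
have /exists_inP[C CP /subsetP sC] := ref _ (pblock_mem xQ).
have xC : x \in C by apply: sC; rewrite mem_pblock.
have yC : y \in C by apply: sC; rewrite eqxy mem_pblock.
by rewrite -(def_pblock tP AP xA) -(def_pblock tP BP yB) (def_pblock tP CP xC)
  (def_pblock tP CP yC).
Qed.

End Refinement.

Section SBound.
Variable R : realType.

(** Test the property on the complete graph on [m] vertices, of density 1 - 1/m, with the partition
    into singletons: every refinement has at least [m] parts. This later lets powers of [S] absorb
    powers of 1/eps. *)
Lemma S_prop_ge (eps delta p : R) (S m : nat) : (0 < m)%N -> m%:R <= eps^-1 ->
  p <= 1 - m%:R^-1 -> S_prop eps delta p S -> (m <= S)%N.
Proof.
move=> m0 meps pm HS.
have [|P eP cP] := @exists_equipartition m m; first by rewrite m0 leqnn.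
have wf : graph_wf [set e : {set 'I_m} | #|e| == 2%N].
  by apply/forall_inP => e; rewrite inE.
have dens : p <= gdensity R [set e : {set 'I_m} | #|e| == 2%N].
  rewrite /gdensity card_draws card_ord; apply: le_trans pm _.
  have -> : (2 * 'C(m, 2) = m * m.-1)%N.
    by rewrite -mul_bin_diag bin1.
  have m0' : m%:R != 0 :> R by rewrite pnatr_eq0 -lt0n.
  rewrite -mulnn !natrM -subn1 natrB // le_eqVlt; apply/orP; left; apply/eqP.
  by field.
have [|E' [_ [_ [Q [/andP[/andP[pQ _] _] [ref cQ]]]]]] := HS _ _ wf dens P eP.
  by rewrite cP.
rewrite -cP; apply: leq_trans cQ; apply: refines_card ref => //.
by case/andP: eP.
Qed.

End SBound.

(** * Edges lost in bad pairs of parts *)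

Section Cleaning.
Variables (R : realType) (n : nat) (E1 E2 Q : {set {set 'I_n}}) (eta tau gam : R).
Hypothesis wf2 : graph_wf E2.
Hypothesis regQ : regular_equipartition E2 eta Q.
Hypothesis tau_ge0 : 0 <= tau.
Hypothesis gam_gt0 : 0 < gam.

Definition good_pair (A B : {set 'I_n}) : bool :=
  [&& A != B, regular_pair E2 eta A B, tau <= dG R E2 A B &
      (eG (E2 :\: E1) A B)%:R <= gam * (eG E2 A B)%:R].

(** Quantifying over [u] and [v] imposes the condition on both orderings of the endpoints, so either
    orientation of an edge yields a good pair. *)
Definition clean_graph : {set {set 'I_n}} :=
  [set e in E1 :&: E2 | [forall u, forall v, (e == [set u; v]) ==>
     good_pair (pblock Q u) (pblock Q v)]].

Let bad_pairs := [set p : 'I_n * 'I_n | adj E2 p.1 p.2 &&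
  ~~ good_pair (pblock Q p.1) (pblock Q p.2)].

Let card_clean_diff : (#|E1 :\: clean_graph| <= #|E1 :\: E2| + #|bad_pairs|)%N.
Proof.
apply: leq_trans (_ : #|(E1 :\: E2) :|: [set [set p.1; p.2] | p in bad_pairs]| <= _)%N.
  apply: subset_leq_card; apply/subsetP => e; rewrite !inE negb_and andbC.
  case: (boolP (e \in E1)) => //= eE1; case: (boolP (e \in E2)) => //= eE2.
  rewrite negb_forall => /existsP[u]; rewrite negb_forall => /existsP[v].
  rewrite negb_imply => /andP[/eqP euv ng]; apply/imsetP; exists (u, v) => //.
  by rewrite inE /= ng andbT /adj -euv.
by apply: leq_trans (leq_card_setU _ _) _; rewrite leq_add2l leq_imset_card.
Qed.

Let eqQ : equipartition Q. Proof. by case/andP: regQ. Qed.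
Let partQ : partition Q [set: 'I_n]. Proof. by case/andP: eqQ. Qed.

Let sum_blocks (F : 'I_n -> 'I_n -> R) :
  \sum_(A in Q) \sum_(B in Q) \sum_(u in A) \sum_(v in B) F u v = \sum_u \sum_v F u v.
Proof.
have sumQ (G : 'I_n -> R) : \sum_(A in Q) \sum_(u in A) G u = \sum_u G u.
  by rewrite -(set_partition_big _ partQ); apply: eq_bigl => u; rewrite inE.
rewrite -[RHS]sumQ; apply: eq_bigr => A _; rewrite exchange_big /=.
by apply: eq_bigr => u _; apply: sumQ.
Qed.

Let card_pairs_sum (P : rel 'I_n) :
  #|[set p : 'I_n * 'I_n | P p.1 p.2]|%:R = \sum_u \sum_v (P u v)%:R :> R.
Proof.
rewrite -sum1dep_card natr_sum big_mkcond pair_big /=.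
by apply: eq_bigr => -[u v] _ /=; case: (P u v).
Qed.

Let k := #|Q|.

(** [irregular_pairs] consists of unordered pairs whereas the sum runs over ordered ones; the factor
    4 comes from [card_ordered_pairs]. *)
Let irregular_sum :
  \sum_(A in Q) \sum_(B in Q) ((A != B) && ~~ regular_pair E2 eta A B)%:R
    <= 4 * (eta * (k ^ 2)%:R).
Proof.
case/andP: regQ => _ irr.
apply: le_trans (_ : (4 * #|irregular_pairs E2 eta Q|)%:R <= _); last first.
  by rewrite natrM ler_pM2l.
have -> : \sum_(A in Q) \sum_(B in Q) ((A != B) && ~~ regular_pair E2 eta A B)%:R =
  #|[set p : {set 'I_n} * {set 'I_n} | [&& p.1 \in Q, p.2 \in Q &
    (p.1 != p.2) && ~~ regular_pair E2 eta p.1 p.2]]|%:R :> R.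
  rewrite -sum1dep_card natr_sum pair_big /=.
  under [RHS]eq_bigl do rewrite andbA.
  rewrite [RHS]big_mkcondr /=; apply: eq_bigr => p _.
  by case: (_ && ~~ _).
rewrite ler_nat; apply: leq_trans (card_ordered_pairs _); last first.
  by move=> e; rewrite !inE => /and3P[_ /eqP].
apply: subset_leq_card; apply/subsetP => -[A B]; rewrite !inE /=.
case/and4P => AQ BQ neq nreg.
rewrite cards2 neq /=; apply/andP; split.
  by apply/subsetP => D; rewrite !inE => /orP[/eqP->|/eqP->].
apply/exists_inP; exists A; rewrite ?set21 //.
by apply/exists_inP; exists B; rewrite ?set22 // neq.
Qed.

(** A lost edge is outside [E2] or in a bad pair, and a pair is bad for one of four reasons. Parts
    have size at most 2n/k, so edges inside parts contribute 2n^2/k and irregular pairs 16 eta n^2.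
    Sparse pairs contribute tau n^2. In the remaining pairs the edges of [E2] number at most 1/gam
    times the added ones, which sums to the last term. *)
Lemma card_clean_diff_le : (0 < n)%N ->
  #|E1 :\: clean_graph|%:R <= #|E1 :\: E2|%:R +
    (2 / k%:R + 16 * eta + tau) * (n ^ 2)%:R + 4 / gam * #|E2 :\: E1|%:R.
Proof.
move=> n0.
apply: le_trans (_ : (#|E1 :\: E2| + #|bad_pairs|)%:R <= _).
  by rewrite ler_nat card_clean_diff.
rewrite natrD -!addrA lerD2l.
have k0 : (0 < k)%N.
  rewrite card_gt0; apply/negP => /eqP Q0.
  have := card_partition partQ; rewrite Q0 big_set0 cardsT card_ord => n0'.
  by rewrite n0' in n0.
have kR : 0 < k%:R :> R by rewrite ltr0n.
have triv : trivIset Q by case/and3P: partQ.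
have -> : #|bad_pairs|%:R =
  \sum_(A in Q) \sum_(B in Q) (~~ good_pair A B)%:R * (eG E2 A B)%:R :> R.
  rewrite (card_pairs_sum (fun u v => adj E2 u v &&
     ~~ good_pair (pblock Q u) (pblock Q v))) -sum_blocks.
  apply: eq_bigr => A AQ; apply: eq_bigr => B BQ.
  rewrite eG_sum mulr_sumr; apply: eq_bigr => u uA.
  rewrite mulr_sumr; apply: eq_bigr => v vB.
  rewrite (def_pblock triv AQ uA) (def_pblock triv BQ vB).
  by case: adj; case: good_pair; rewrite /= ?(mulr0, mul0r, mulr1).
pose M : R := 2 * n%:R / k%:R.
have szM A : A \in Q -> #|A|%:R <= M.
  move=> AQ; rewrite /M ler_pdivlMr // -!natrM ler_nat mulnC.
  exact: equipartition_upper.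
have M0 : 0 <= M by rewrite /M divr_ge0 // mulr_ge0.
have sumn : \sum_(A in Q) #|A|%:R = n%:R :> R.
  by rewrite -natr_sum -(card_partition partQ) cardsT card_ord.
have sumF : \sum_(A in Q) \sum_(B in Q) (eG (E2 :\: E1) A B)%:R
    <= 4 * #|E2 :\: E1|%:R :> R.
  under eq_bigr do under eq_bigr do rewrite eG_sum.
  rewrite sum_blocks -(card_pairs_sum (adj (E2 :\: E1))) -natrM ler_nat.
  apply: card_ordered_pairs => e; rewrite inE => /andP[_ eE].
  by apply/eqP; move/forall_inP: wf2; apply.
have pt A B : A \in Q -> B \in Q ->
  (~~ good_pair A B)%:R * (eG E2 A B)%:R <=
    (A == B)%:R * (M * #|A|%:R) +
    ((A != B) && ~~ regular_pair E2 eta A B)%:R * M ^+ 2 +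
    tau * (#|A|%:R * #|B|%:R) + gam^-1 * (eG (E2 :\: E1) A B)%:R.
  move=> AQ BQ.
  have hA := szM A AQ; have hB := szM B BQ.
  have a0 : 0 <= #|A|%:R :> R by [].
  have b0 : 0 <= #|B|%:R :> R by [].
  have eAB : (eG E2 A B)%:R <= #|A|%:R * #|B|%:R :> R by rewrite -natrM ler_nat eG_le.
  have t1 : 0 <= (A == B)%:R * (M * #|A|%:R).
    by rewrite mulr_ge0 // mulr_ge0.
  have t2 : 0 <= ((A != B) && ~~ regular_pair E2 eta A B)%:R * M ^+ 2.
    by rewrite mulr_ge0 // exprn_ge0.
  have t3 : 0 <= tau * (#|A|%:R * #|B|%:R) by rewrite !mulr_ge0.
  have t4 : 0 <= gam^-1 * (eG (E2 :\: E1) A B)%:R by rewrite mulr_ge0 // invr_ge0 ltW.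
  case: (boolP (good_pair A B)) => [_|]; first by rewrite mul0r !addr_ge0.
  rewrite mul1r /good_pair; move: t1 t2.
  case: (eqVneq A B) => [eqAB|neq] /=.
    rewrite -eqAB in eAB t3 t4 *.
    rewrite mul1r mul0r => t1 _ _.
    have : #|A|%:R * #|A|%:R <= M * #|A|%:R by rewrite ler_wpM2r.
    lra.
  rewrite mul0r; case: (boolP (regular_pair _ _ _ _)) => [_|_] /=; last first.
    rewrite mul1r => t1 _ _; apply: le_trans eAB _.
    have : #|A|%:R * #|B|%:R <= M ^+ 2 by rewrite expr2 ler_pM.
    lra.
  case: (lerP tau (dG R E2 A B)) => [_|low] /= t1 _; last first.
    move=> _; rewrite -dG_mul natrM.
    have := ler_wpM2r (mulr_ge0 a0 b0) (ltW low); lra.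
  rewrite -ltNge => hF.
  have : (eG E2 A B)%:R <= gam^-1 * (eG (E2 :\: E1) A B)%:R :> R.
    by rewrite ler_pdivlMl // ltW.
  lra.
apply: le_trans (_ : \sum_(A in Q) \sum_(B in Q)
   ((A == B)%:R * (M * #|A|%:R) +
    ((A != B) && ~~ regular_pair E2 eta A B)%:R * M ^+ 2 +
    tau * (#|A|%:R * #|B|%:R) + gam^-1 * (eG (E2 :\: E1) A B)%:R) <= _).
  by apply: ler_sum => A AQ; apply: ler_sum => B BQ; apply: pt.
under eq_bigr do rewrite !big_split /=.
rewrite !big_split /=.
have -> : \sum_(A in Q) \sum_(B in Q) (A == B)%:R * (M * #|A|%:R) = 2 / k%:R * (n ^ 2)%:R.
  have -> : 2 / k%:R * (n ^ 2)%:R = M * n%:R :> R.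
    by rewrite /M natrX; ring.
  rewrite -sumn mulr_sumr; apply: eq_bigr => A AQ.
  rewrite (bigD1 A) //= eqxx mul1r big1 ?addr0 // => B /andP[_ neq].
  by rewrite eq_sym (negPf neq) mul0r.
have s2 : \sum_(A in Q) \sum_(B in Q)
    ((A != B) && ~~ regular_pair E2 eta A B)%:R * M ^+ 2 <= 16 * eta * (n ^ 2)%:R.
  under eq_bigr do rewrite -mulr_suml.
  rewrite -mulr_suml; apply: le_trans (ler_wpM2r (sqr_ge0 M) irregular_sum) _.
  rewrite /M !natrX le_eqVlt; apply/orP; left; apply/eqP; field.
  by rewrite gt_eqF.
have -> : \sum_(A in Q) \sum_(B in Q) tau * (#|A|%:R * #|B|%:R) = tau * (n ^ 2)%:R.
  rewrite natrX expr2 -sumn !mulr_suml mulr_sumr; apply: eq_bigr => A AQ.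
  by rewrite !mulr_sumr.
have s4 : \sum_(A in Q) \sum_(B in Q) gam^-1 * (eG (E2 :\: E1) A B)%:R
    <= 4 / gam * #|E2 :\: E1|%:R.
  under eq_bigr do rewrite -mulr_sumr.
  rewrite -mulr_sumr [4 / gam]mulrC -mulrA ler_wpM2l // invr_ge0 ltW //.
lra.
Qed.

End Cleaning.

(** * Copies and embeddings *)

(** Union bound over pairs of indices: for [i] and [j] distinct, exactly one value of the coordinate
    [i] produces a collision with [x j]. *)
Lemma card_noninjective_le (R : realFieldType) (I V : finType) :
  #|V|%:R * #|[set x : {ffun I -> V} | ~~ injectiveb x]|%:R
    <= (#|I| ^ 2 * #|V| ^ #|I|)%:R :> R.
Proof.
pose c (_ : I) := [set: V].
have boxT : box c = setT by apply/setP => x; rewrite !inE; apply/forallP => i; rewrite inE.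
pose T (p : I * I) : R := \sum_(x in box c) ((p.1 != p.2) && (x p.1 == x p.2))%:R.
have TE p : #|V|%:R * T p <= (#|V| ^ #|I|)%:R.
  case: p => i j; rewrite /T /=; case: (eqVneq i j) => [_|neij] /=.
    by rewrite big1 ?mulr0.
  have := sum_upd c (fun x : {ffun I -> V} => (x i == x j)%:R : R) i.
  rewrite cardsT => ->; rewrite -card_ffun -cardsT -boxT -sum1_card natr_sum.
  apply: ler_sum => x _; rewrite (bigD1 (x j)) ?inE //= big1 => [|u /andP[_ ux]].
    by rewrite !ffunE eqxx (eq_sym j) (negPf neij) eqxx addr0.
  by rewrite !ffunE eqxx (eq_sym j) (negPf neij) (negPf ux).
apply: le_trans (_ : #|V|%:R * (\sum_p T p) <= _).
  rewrite ler_wpM2l // -sum1dep_card natr_sum big_mkcond /T exchange_big /= boxT.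
  rewrite [leRHS](eq_bigl xpredT) => [|x]; last by rewrite inE.
  apply: ler_sum => x _; case: ifP => [/injectivePn[i [j neij eqx]]|_]; last exact: sumr_ge0.
  by rewrite (bigD1 (i, j)) //= neij eqx eqxx lerDl sumr_ge0.
rewrite mulr_sumr; apply: le_trans (ler_sum _ (fun p _ => TE p)) _.
by rewrite sumr_const -[leLHS]mulr_natl -natrM ler_nat leq_mul2r card_prod mulnn leqnn orbT.
Qed.

Section Copies.
Variables (h n : nat) (EH : {set {set 'I_h}}).
Implicit Types (E : {set {set 'I_n}}).

(** Embeddings giving the same copy all map into its vertex set, which has at most [h] points. *)
Lemma card_embeddings_le E : (#|embeddings EH E| <= h ^ h * copies EH E)%N.
Proof.
rewrite /copies; set F := fun f : {ffun 'I_h -> 'I_n} => (_, _).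
rewrite -[leqLHS]sum1_card (partition_big F (mem (F @: embeddings EH E))) /=; last first.
  by move=> f fE; apply: imset_f.
rewrite mulnC -sum_nat_const; apply: leq_sum => _ /imsetP[f0 _ ->].
rewrite sum1dep_card; set W := f0 @: [set: 'I_h].
apply: leq_trans (_ : #|ffun_on (mem W)| <= _)%N.
  apply: subset_leq_card; apply/subsetP => f; rewrite inE => /andP[_ /eqP[eqW _]].
  by apply/ffun_onP => i; rewrite /W -eqW; apply: imset_f.
have leX a b k : (a <= b -> a ^ k <= b ^ k)%N.
  by case: k => [|k] ab; rewrite ?expn0 // leq_exp2r.
rewrite card_ffun_on card_ord; apply: leX.
by apply: leq_trans (leq_imset_card _ _) _; rewrite cardsT card_ord.
Qed.

Lemma copies_gt0 E : ~~ Hfree EH E -> (0 < copies EH E)%N.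
Proof.
case/set0Pn => f fE; rewrite /copies; set F := fun f : {ffun 'I_h -> 'I_n} => (_, _).
by apply/card_gt0P; exists (F f); apply: imset_f.
Qed.

Lemma embeddingsS E E' : E' \subset E -> embeddings EH E' \subset embeddings EH E.
Proof.
move=> /subsetP sE; apply/subsetP => f /embeddingsP[fi fE].
by apply/embeddingsP; split=> // e /fE /sE.
Qed.

Hypothesis wfH : graph_wf EH.

(** Orienting each edge upwards lists it only once, so distinct entries are nonparallel. *)
Definition oriented_edges : seq ('I_h * 'I_h) :=
  [seq p : 'I_h * 'I_h <- enum {: 'I_h * 'I_h} | (p.1 < p.2)%N && ([set p.1; p.2] \in EH)].

Lemma mem_oriented (p : 'I_h * 'I_h) :
  (p \in oriented_edges) = (p.1 < p.2)%N && ([set p.1; p.2] \in EH).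
Proof. by rewrite mem_filter mem_enum andbT. Qed.

Lemma hom_embedding E (x : {ffun 'I_h -> 'I_n}) :
  is_hom (adj E) x oriented_edges -> injectiveb x -> x \in embeddings EH E.
Proof.
move=> /allP hx /injectiveP xi; apply/embeddingsP; split=> // e eH.
have /cards2P[i [j [neij ee]]] : #|e| == 2%N by exact: (forall_inP wfH).
subst e; have im k l : x @: [set k; l] = [set x k; x l].
  by rewrite imsetU1 imset_set1.
case: (ltngtP i j) => [ij|ji|/val_inj eij]; last by rewrite eij eqxx in neij.
  by rewrite im; apply: (hx (i, j)); rewrite mem_oriented ij.
by rewrite setUC im; apply: (hx (j, i)); rewrite mem_oriented ji setUC.
Qed.

Lemma card_edges_le : (#|EH| <= h ^ 2)%N.
Proof.
apply: leq_trans (_ : #|[set e : {set 'I_h} | #|e| == 2%N]| <= _)%N.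
  by apply: subset_leq_card; apply/subsetP => e eH; rewrite inE; exact: (forall_inP wfH).
rewrite card_draws card_ord; have := mul_bin_diag h 1; rewrite bin1; nia.
Qed.

(** A surviving copy [f0] assigns to each vertex of H the part containing its image, and every edge
    of H then spans a good pair. [clean_copies] applies to the product of these parts, which
    contains at least (n / (2|Q|))^h points. Parts of nonadjacent vertices may coincide, so
    non-injective maps are counted as well. *)
Lemma many_embeddings (R : realType) (E1 E2 Q : {set {set 'I_n}}) (eta tau : R) :
  (0 < h)%N -> equipartition Q -> 0 <= eta -> 0 < tau <= 1 ->
  (2 * h ^ 2).+1%:R * eta <= tau ^+ (2 * h ^ 2) ->
  ~~ Hfree EH (clean_graph E1 E2 Q eta tau (((8 * h ^ 2)%:R)^-1 ^+ 2)) ->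
  tau ^+ (h ^ 2) * (n ^ h)%:R <=
    4 * ((2 * #|Q|) ^ h)%:R *
    (#|embeddings EH E1| + #|[set x : {ffun 'I_h -> 'I_n} | ~~ injectiveb x]|)%:R.
Proof.
move=> h0 eqQ eta0 tau01 small /set0Pn[f0 /embeddingsP[f0i f0E]].
have /andP[pQ _] := eqQ.
pose c i := pblock Q (f0 i).
have cQ i : c i \in Q by apply: pblock_mem; rewrite (cover_partition pQ).
have c0 i : (0 < #|c i|)%N.
  by rewrite card_gt0; apply: contraTneq (cQ i) => ->; case/and3P: pQ.
pose d (p : 'I_h * 'I_h) := dG R E2 (c p.1) (c p.2).
have good p : p \in oriented_edges ->
    good_pair E1 E2 eta tau (((8 * h ^ 2)%:R)^-1 ^+ 2) (c p.1) (c p.2).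
  rewrite mem_oriented => /andP[_ /f0E]; rewrite imsetU1 imset_set1 inE => /andP[_].
  by move/forallP/(_ (f0 p.1))/forallP/(_ (f0 p.2)); rewrite eqxx.
have := @clean_copies R 'I_h 'I_n (adj E2) (adj (E2 :\: E1)) c d eta tau (h ^ 2)
  c0 eta0 tau01 _ small oriented_edges.
rewrite expn_gt0 h0 => /(_ isT).
have szs : (size oriented_edges <= h ^ 2)%N.
  rewrite size_filter; apply: leq_trans (count_size _ _) _.
  by rewrite -cardE card_prod card_ord mulnn.
have H1 : all (fun q : 'I_h * 'I_h => q.1 != q.2) oriented_edges.
  by apply/allP => q; rewrite mem_oriented => /andP[+ _]; rewrite ltn_neqAle => /andP[].
have H2 : uniq oriented_edges by rewrite filter_uniq // enum_uniq.
have H3 : {in oriented_edges &, forall p q, p != q -> nonparallel p q}.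
  move=> [i j] [i' j']; rewrite !mem_oriented /= => /andP[ij _] /andP[ij' _].
  apply: contraNN => /=; rewrite !inE => /andP[/orP[]/eqP hi /orP[]/eqP hj]; subst => //;
    by move: ij ij'; rewrite ?ltnn // => /ltn_trans h1 /h1; rewrite ltnn.
have H4 : {in oriented_edges, forall p, discrepancy_le (adj E2) c d eta p}.
  by move=> p /good /and4P[_ reg _ _] A B; apply: regular_discrepancy.
have H5 : {in oriented_edges, forall p, tau <= d p <= 1}.
  by move=> p /good /and4P[_ _ td _]; rewrite /d td dG_le1.
have H6 : subrel (adj (E2 :\: E1)) (adj E2).
  by move=> u v; rewrite /adj inE => /andP[].
have H7 : {in oriented_edges, forall p,
    \sum_(u in c p.1) \sum_(v in c p.2) (adj (E2 :\: E1) u v)%:R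
    <= ((8 * h ^ 2)%:R^-1) ^+ 2 * d p * (#|c p.1| * #|c p.2|)%:R}.
  by move=> p /good /and4P[_ _ _]; rewrite -eG_sum -mulrA dG_mul.
move=> /(_ H1 H2 H3 szs H4 H5 H6 H7) main.
have sumle : \sum_(x in box c)
    (is_hom (fun u v => adj E2 u v && ~~ adj (E2 :\: E1) u v) x oriented_edges)%:R
  <= (#|embeddings EH E1| + #|[set x : {ffun 'I_h -> 'I_n} | ~~ injectiveb x]|)%:R :> R.
  rewrite -natr_sum ler_nat; apply: leq_trans (leq_card_setU _ _).
  rewrite -sum1_card [leqRHS]big_mkcond /= [leqLHS]big_mkcond /=.
  apply: leq_sum => x _; case: (x \in box c) => //.
  case hx: (is_hom _ _ _) => //; rewrite in_setU inE.
  case inj: (injectiveb x); last by rewrite orbT.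
  rewrite hom_embedding //; apply: sub_all hx => p /=.
  by rewrite /adj inE; case: (_ \in E1) => //=; case: (_ \in E2).
have boxle : (n ^ h)%:R <= ((2 * #|Q|) ^ h)%:R * #|box c|%:R :> R.
  have pe m : (m ^ h = \prod_(i < h) m)%N by rewrite prod_nat_const card_ord.
  rewrite -natrM ler_nat card_box !pe -big_split /=.
  by apply: leq_prod => i _; apply: equipartition_lower.
have t0 : 0 <= tau ^+ (h ^ 2) by rewrite exprn_ge0 // ltW //; case/andP: tau01.
apply: le_trans (ler_wpM2l t0 boxle) _.
have {}main := le_trans main sumle.
rewrite mulrCA -mulrA [leRHS]mulrCA ler_wpM2l //.
by rewrite -(ler_pM2l (_ : 0 < 4^-1 :> R)) ?invr_gt0 // !mulrA mulVf
  ?pnatr_eq0 // mul1r [_^-1 * _]mulrC.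
Qed.

End Copies.

(** * Removal *)

(** For [n] this large the non-injective maps account for at most half of the lower bound. The
    remaining constant 8 * 2^h * h^h is paid for by one extra factor [S]. *)
Lemma removal_count (h L S n J emb c : nat) :
  (0 < L)%N -> (0 < h)%N -> (100 * L * 2 ^ h * h ^ h <= S)%N ->
  (S ^ (h + L + 1) < n)%N -> (n * J <= L * n ^ h)%N ->
  (n ^ h <= 4 * (2 ^ h * S ^ (h + L)) * (emb + J))%N -> (emb <= h ^ h * c)%N ->
  (n ^ h <= S ^ (h + L + 1) * c)%N.
Proof.
move=> L0 h0; have a0 : (0 < 2 ^ h)%N by rewrite expn_gt0.
have b0 : (0 < h ^ h)%N by rewrite expn_gt0 h0.
rewrite addn1 expnS; move: (2 ^ h)%N (h ^ h)%N (n ^ h)%N (S ^ (h + L))%N a0 b0.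
move=> a b N s a0 b0 KS nS Jle main embc.
have nL : (8 * (a * s) * L <= n)%N.
  apply: leq_trans (ltnW nS).
  have -> : (8 * (a * s) * L = (8 * L * a) * s)%N by ring.
  rewrite leq_mul2r; apply/orP; right; apply: leq_trans KS.
  by apply: leq_trans (leq_pmulr _ b0); rewrite !leq_mul2r !orbT.
have Jsmall : (8 * (a * s) * J <= N)%N.
  rewrite -(leq_pmul2l (leq_ltn_trans (leq0n _) nS)).
  apply: leq_trans (_ : 8 * (a * s) * (n * J) <= _)%N.
    by rewrite mulnCA.
  apply: leq_trans (leq_mul (leqnn _) Jle) _.
  by rewrite mulnA leq_mul2r nL orbT.
have half : (N <= 8 * (a * s) * emb)%N by move: Jsmall main; clear; lia.
apply: leq_trans half _; apply: leq_trans (leq_mul (leqnn _) embc) _.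
rewrite mulnA leq_mul2r; apply/orP; right.
have -> : (8 * (a * s) * b = (8 * a * b) * s)%N by ring.
rewrite leq_mul2r; apply/orP; right; apply: leq_trans KS.
rewrite leq_mul2r; apply/orP; right; rewrite leq_mul2r; apply/orP; right.
by move: L0; clear; lia.
Qed.

Section Removal.
Variables (R : realType) (h n : nat) (EH : {set {set 'I_h}}) (E : {set {set 'I_n}}).
Variables (eps eta : R) (S m : nat).
Local Notation L := (h ^ 2)%N.
Hypotheses (h_gt0 : (0 < h)%N) (n_gt0 : (0 < n)%N).
Hypotheses (wfH : graph_wf EH) (wfE : graph_wf E).
Hypotheses (eps_gt0 : 0 < eps) (eps_small : eps * (100 * L)%:R <= 1).
Hypothesis far : forall E' : {set {set 'I_n}}, E' \subset E -> Hfree EH E' ->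
  eps * (n ^ 2)%:R <= #|E :\: E'|%:R.
Hypothesis S_eta : S_prop eta (((1024 * L ^ 3)%:R)^-1) eps S.
Hypotheses (eta_gt0 : 0 < eta) (eta_le : eta <= eps ^+ (4 * L).+1).
Hypotheses (m_ge : eps ^- 2 <= m%:R) (m_le : m%:R <= eta^-1) (mn : (m <= n)%N).

(** The property of [S] is applied to [E1] rather than [E]: making [E1] free of H costs a fraction
    1/L of its own edges, which a change of a fraction 1/(1024 L^3) cannot offset. *)
Lemma removal_embeddings : EH != set0 ->
  eps ^+ (2 * L) * (n ^ h)%:R <= 4 * ((2 * S) ^ h)%:R *
    (#|embeddings EH E| + #|[set x : {ffun 'I_h -> 'I_n} | ~~ injectiveb x]|)%:R.
Proof.
move=> EH0.
have L0 : (0 < L)%N by rewrite expn_gt0 h_gt0.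
have LR : 1 <= L%:R :> R by rewrite ler1n.
have eL : eps * L%:R <= 1 / 100 by move: eps_small; rewrite natrM; lra.
have e1 : eps <= 1 / 100.
  by apply: le_trans eL; rewrite ler_peMr // ltW.
have e0 := ltW eps_gt0.
have [E1 [sE1 F1 far1]] := exists_far_subgraph E EH0 (card_edges_le wfH).
have cE1 : eps * (n ^ 2)%:R <= #|E1|%:R.
  have := far (subsetDl _ _) F1.
  by rewrite setDDr setDv set0U (setIidPr sE1).
have n2 : 0 < (n ^ 2)%:R :> R by rewrite ltr0n expn_gt0 n_gt0.
have dE1 : eps <= gdensity R E1.
  rewrite /gdensity ler_pdivlMr //; apply: le_trans cE1 _.
  by rewrite ler_nat leq_pmull.
have wf1 : graph_wf E1.
  by apply/forall_inP => e /(subsetP sE1); apply: (forall_inP wfE).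
have m0 : (0 < m)%N.
  by rewrite -(ltr0n R); apply: lt_le_trans m_ge; rewrite invr_gt0 exprn_gt0.
have [|P0 eP0 cP0] := @exists_equipartition n m; first by rewrite m0.
have [|E2 [wf2 [diff [Q [rQ [ref QS]]]]]] := S_eta wf1 dE1 eP0; first by rewrite cP0.
have /andP[eQ _] := rQ.
have mQ : (m <= #|Q|)%N.
  rewrite -cP0; apply: refines_card ref; first by case/andP: eP0.
  by case/andP: eQ.
(* Since [E1] has at least eps n^2 edges, a loss of order eps^2 n^2 is only of order eps |E1|; this
   dictates [tau] and the lower bound on [m]. *)
pose tau := eps ^+ 2; pose g : R := (8 * L)%:R^-1.
have g0 : 0 < g by rewrite invr_gt0 ltr0n muln_gt0.
have eta2 : eta <= eps ^+ 2.
  apply: le_trans eta_le _; apply: ler_wiXn2l => //; first by lra.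
  by rewrite ltnS muln_gt0 L0.
(* Otherwise [L] times the loss would be at least a = |E1|. But it is at most a/1024 for the edges
   outside [E2], plus 19a/100 for the terms in n^2, plus 256a/1024 for the pairs with many added
   edges. *)
have nfree : ~~ Hfree EH (clean_graph E1 E2 Q eta tau (g ^+ 2)).
  apply/negP => free.
  have := far1 _ _ free.
  have sC : clean_graph E1 E2 Q eta tau (g ^+ 2) \subset E1.
    by apply/subsetP => e; rewrite !inE => /andP[/andP[]].
  move=> /(_ sC); rewrite -(ler_nat R) natrM.
  have := @card_clean_diff_le R n E1 E2 Q eta tau (g ^+ 2) wf2 rQ (exprn_ge0 _ e0)
    (exprn_gt0 _ g0) n_gt0.
  set X := #|_ :\: clean_graph _ _ _ _ _ _|%:R => cl far1'.
  set a : R := #|E1|%:R in cE1 diff cl far1' *.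
  have a0 : 0 < a by apply: lt_le_trans cE1; rewrite mulr_gt0.
  have kinv : 2 / #|Q|%:R <= 2 * eps ^+ 2.
    rewrite ler_pM2l //.
    have k0 : 0 < #|Q|%:R :> R by rewrite ltr0n; apply: leq_trans mQ.
    rewrite -[leRHS]invrK lef_pV2 ?posrE ?invr_gt0 ?exprn_gt0 //.
    by apply: le_trans m_ge _; rewrite ler_nat.
  have coef : (2 / #|Q|%:R + 16 * eta + tau) * (n ^ 2)%:R <= 19 * eps * a.
    apply: le_trans (_ : 19 * eps ^+ 2 * (n ^ 2)%:R <= _).
      rewrite ler_pM2r //; rewrite /tau; lra.
    by rewrite expr2 mulrA -mulrA ler_pM2l // mulr_gt0.
  have gi : 4 / (g ^+ 2) = 256 * L%:R ^+ 2.
    by rewrite /g natrM; field; rewrite pnatr_eq0 -lt0n.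
  rewrite gi in cl.
  have LD : L%:R ^+ 3 * #|(E1 :\: E2) :|: (E2 :\: E1)|%:R <= a / 1024.
    rewrite mulrC -ler_pdivlMr ?exprn_gt0 ?ltr0n //; apply: le_trans diff _.
    rewrite natrM natrX invfM le_eqVlt; apply/orP; left; apply/eqP; ring.
  have c1 : #|E1 :\: E2|%:R <= #|(E1 :\: E2) :|: (E2 :\: E1)|%:R :> R.
    by rewrite ler_nat subset_leq_card // subsetUl.
  have c2 : #|E2 :\: E1|%:R <= #|(E1 :\: E2) :|: (E2 :\: E1)|%:R :> R.
    by rewrite ler_nat subset_leq_card // subsetUr.
  set b := #|(E1 :\: E2) :|: (E2 :\: E1)|%:R in diff LD c1 c2.
  have b0 : 0 <= b :> R by rewrite /b.
  have L1 : L%:R * b <= L%:R ^+ 3 * b :> R.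
    by rewrite ler_wpM2r // exprS ler_peMr ?exprn_ege1 // ltW // ltr0n.
  have X1 : L%:R * X <= L%:R * (b + 19 * eps * a + 256 * L%:R ^+ 2 * b).
    rewrite ler_pM2l ?ltr0n //; apply: le_trans cl _.
    have : 256 * L%:R ^+ 2 * #|E2 :\: E1|%:R <= 256 * L%:R ^+ 2 * b :> R.
      by rewrite ler_wpM2l // mulr_ge0 // exprn_ge0.
    lra.
  have X2 : L%:R * (b + 19 * eps * a + 256 * L%:R ^+ 2 * b) =
     L%:R * b + 19 * ((eps * L%:R) * a) + 256 * (L%:R ^+ 3 * b) by ring.
  have X3 : (eps * L%:R) * a <= 1 / 100 * a by rewrite ler_pM2r.
  lra.
have := many_embeddings wfH h_gt0 eQ (ltW eta_gt0) _ _ nfree.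
have t01 : 0 < tau <= 1.
  by rewrite exprn_gt0 //= exprn_ile1 //; lra.
have small : (2 * L).+1%:R * eta <= tau ^+ (2 * L).
  apply: le_trans (ler_wpM2l _ eta_le) _ => //.
  rewrite /tau -exprM exprS mulrA (_ : (2 * (2 * L) = 4 * L)%N); last by rewrite mulnA.
  rewrite ger_pMl ?exprn_gt0 // -natr1 natrM; lra.
move=> /(_ t01 small); rewrite /tau -exprM => /le_trans; apply.
apply: ler_pM; rewrite ?mulr_ge0 //.
  rewrite ler_pM2l // ler_nat leq_exp2r // leq_pmul2l //.
by rewrite ler_nat leq_add2r; apply: subset_leq_card; apply: embeddingsS.
Qed.

End Removal.

Theorem theorem1p2 (R : realType) (h : nat) : (3 <= h)%N ->
  exists eps0 delta0 C : R, 0 < eps0 /\ 0 < delta0 /\ 0 < C /\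
  forall EH : {set {set 'I_h}}, graph_wf EH ->
  forall eps : R, 0 < eps -> eps <= eps0 ->
  forall S : nat, S_prop (eps `^ C) delta0 eps S ->
  Rem_prop EH eps ((S%:R) `^ C).
Proof.
move=> h3; have h0 : (0 < h)%N by apply: leq_trans h3.
pose L := (h ^ 2)%N; pose K := (100 * L * 2 ^ h * h ^ h)%N.
(* [S ^ B] is the threshold between small and large [n]. In [N], the summand [B * h] serves small
   [n], and [(4 * L).+1] makes eps^N small enough for the counting lemma. The choice of 1/K as upper
   bound for eps will force [K <= S]. *)
pose B := (h + L + 1)%N; pose N := (B * h + (4 * L).+1)%N.
have L0 : (0 < L)%N by rewrite expn_gt0 h0.
have K0 : (0 < K)%N by rewrite /K /L !(muln_gt0, expn_gt0) h0.
exists K%:R^-1, (1024 * L ^ 3)%:R^-1, N%:R.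
split; first by rewrite invr_gt0 ltr0n.
split; first by rewrite invr_gt0 ltr0n muln_gt0 expn_gt0 L0.
split; first by rewrite ltr0n /N addnS.
move=> EH wfH eps e0 eK S HS n E wfE far.
have epsK : eps * K%:R <= 1 by rewrite -ler_pdivlMr ?ltr0n // mul1r.
have epsL : eps * (100 * L)%:R <= 1.
  apply: le_trans epsK; rewrite ler_pM2l // ler_nat /K -mulnA leq_pmulr //.
  by rewrite muln_gt0 !expn_gt0 h0.
have e1 : eps <= 1 / 100.
  have : 1 <= L%:R :> R by rewrite ler1n.
  move: epsL; rewrite natrM; nra.
have e1' : eps <= 1 by lra.
rewrite !powR_mulrn ?(ltW e0) // in HS *.
pose eta := eps ^+ N.
have eta0 : 0 < eta by rewrite exprn_gt0.
(* The initial partition needs at least eps^-2 parts, so that few edges lie inside parts, yet at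
   most 1/eta; [m] is at most eps^-2 + 1, hence at most eps^-3. *)
pose m := (Num.truncn (eps ^- 2)).+1.
have m_ge : eps ^- 2 <= m%:R by apply: ltW; apply: truncnS_gt.
have einv : 100 <= eps^-1.
  by rewrite -[leLHS]invrK lef_pV2 ?posrE ?invr_gt0 // -div1r.
have m_le : m%:R <= eta^-1.
  have : m%:R <= eps ^- 2 + 1.
    by rewrite /m -natr1 lerD2r truncn_le // invr_ge0 exprn_ge0 // ltW.
  move=> /le_trans; apply; apply: le_trans (_ : eps ^- 3 <= _).
    by rewrite -!exprVn; nra.
  rewrite lef_pV2 ?posrE ?exprn_gt0 //; apply: ler_wiXn2l => //; first exact: ltW.
  apply: leq_trans (leq_addl _ _); rewrite ltnS.
  by apply: leq_trans (_ : 4 * 1 <= _)%N; rewrite ?leq_mul2l.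
have mS : (m <= S)%N.
  apply: S_prop_ge m_le _ HS => //.
  have : m%:R^-1 <= eps ^+ 2.
    by rewrite -[leRHS]invrK lef_pV2 ?posrE ?invr_gt0 ?exprn_gt0 // ltr0n.
  nra.
have SR : eps ^- 2 <= S%:R by apply: le_trans m_ge _; rewrite ler_nat.
have KS : (K <= S)%N.
  rewrite -(ler_nat R); apply: le_trans SR.
  have : K%:R <= eps^-1 by rewrite -[leRHS]div1r ler_pdivlMr // mulrC.
  rewrite -exprVn; nra.
have S0 : (0 < S)%N by apply: leq_trans K0 KS.
have [n0|n0] := posnP n; first by subst n; rewrite exp0n // mulr_ge0 // exprn_ge0.
have nfree : ~~ Hfree EH E.
  apply/negP => /(far _ (subxx E)); rewrite setDv cards0 leNgt => /negP; apply.
  by rewrite mulr_gt0 // ltr0n expn_gt0 n0.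
rewrite -natrX -natrM ler_nat.
(* For small [n] a single copy suffices, since n^h is at most S^(B h). *)
have [nS|nS] := leqP n (S ^ B).
  apply: leq_trans (_ : S ^ N * 1 <= _)%N; last by rewrite leq_mul2l copies_gt0 ?orbT.
  rewrite muln1; apply: leq_trans (_ : (S ^ B) ^ h <= _)%N; first by rewrite leq_exp2r.
  by rewrite -expnM leq_pexp2l // /N leq_addr.
set c := copies EH E.
set J := #|[set x : {ffun 'I_h -> 'I_n} | ~~ injectiveb x]|.
have Jle : (n * J <= L * n ^ h)%N.
  by have := card_noninjective_le R 'I_h 'I_n; rewrite !card_ord -natrM ler_nat.
have main : (n ^ h <= 4 * (2 ^ h * S ^ (h + L)) * (#|embeddings EH E| + J))%N.
  (* For H without edges every injective map is an embedding. *)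
  have [EH0|EH0] := eqVneq EH set0.
    apply: leq_trans (_ : #|embeddings EH E| + J <= _)%N; last first.
      by rewrite leq_pmull // !muln_gt0 !expn_gt0 S0.
    rewrite -{1}[h]card_ord -{1}[n]card_ord -card_ffun -cardsT.
    apply: leq_trans (leq_card_setU _ _); apply: subset_leq_card.
    apply/subsetP => x _; rewrite in_setU [in X in _ || X]inE orbC.
    case: (boolP (injectiveb x)) => //= /injectiveP xi.
    by apply/embeddingsP; split=> // e; rewrite EH0 inE.
  have mn : (m <= n)%N.
    apply: leq_trans mS _; apply: leq_trans (ltnW nS).
    by rewrite -{1}[S]expn1 leq_pexp2l // /B addn1.
  have eta_le : eta <= eps ^+ (4 * L).+1.
    by apply: ler_wiXn2l => //; [exact: ltW|rewrite /N leq_addl].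
  have := removal_embeddings h0 n0 wfH wfE e0 epsL far HS eta0 eta_le m_ge m_le mn EH0.
  rewrite -/L -/J => main.
  (* As [S] is at least eps^-2, the factor eps^(2L) lost in counting costs at most [S ^ L]. *)
  have SL : 1 <= (S ^ L)%:R * eps ^+ (2 * L).
    have : 1 <= S%:R * eps ^+ 2.
      by rewrite -ler_pdivrMr ?exprn_gt0 // mul1r.
    by move=> /(exprn_ege1 L); rewrite exprMn -exprM natrX.
  rewrite -(ler_nat R).
  apply: le_trans (_ : ((S ^ L)%:R * eps ^+ (2 * L)) * (n ^ h)%:R <= _).
    by rewrite ler_peMl.
  rewrite -mulrA; apply: le_trans (ler_wpM2l _ main) _ => //.
  rewrite !natrM !natrD expnMn expnD !natrM; lra.
have := removal_count L0 h0 KS nS Jle main (card_embeddings_le EH E).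
move=> /leq_trans; apply; rewrite leq_mul2r leq_pexp2l ?orbT //.
by rewrite /N -/B; apply: leq_trans (leq_addr _ _); apply: leq_pmulr.
Qed.
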